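(* Let $R$ be a ring and let $\mathcal{I}$ be an ideal of $\operatorname{Hom}_R$ (in the category of left $R$-modules) that is generated by a set of homomorphisms $\{f_k : M_k\to N_k\}_{k\in K}$. Then $\mathcal{I}^{\perp}$ is preenveloping, i.e. every left $R$-module has an $\mathcal{I}^{\perp}$-preenvelope.
   Context: $R$ is an arbitrary ring; modules are left $R$-modules. An ideal $\mathcal{I}$ is an additive subfunctor of $\operatorname{Hom}_R$, i.e. a class of $R$-homomorphisms such that for all modules $M,N$ the members of $\mathcal I$ from $M$ to $N$ form a subgroup of $\operatorname{Hom}_R(M,N)$, and $f\circ g\circ h\in\mathcal{I}$ whenever $g\in\mathcal{I}$ and $f,h$ are composable homomorphisms. The ideal generated by a set of homomorphisms is the smallest ideal containing that set. For homomorphisms $i: Z\to Y$ and $j:U\to V$, $\operatorname{Ext}^1(i,j):\operatorname{Ext}^1_R(Y,U)\to\operatorname{Ext}^1_R(Z,V)$ is the map sending (the class of) a short exact sequence $0\to U\to X\to Y\to 0$ to the one obtained by pushout along $j$ followed by pullback along $i$. For an ideal $\mathcal{I}$, $\mathcal{I}^{\perp}=\{j \mid \operatorname{Ext}^1(i,j)=0 \text{ for all } i\in\mathcal{I}\}$. For an ideal $\mathcal{J}$, a $\mathcal{J}$-preenvelope of a module $U$ is a homomorphism $j:U\to J$ in $\mathcal{J}$ such that every homomorphism $j':U\to J'$ in $\mathcal{J}$ with domain $U$ factors as $j'=h\circ j$ for some homomorphism $h:J\to J'$. *)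

(* Defs.v *)
From HB Require Import structures.
From mathcomp Require Import all_boot all_order all_algebra.
From mathcomp Require Import boolp.

Set Implicit Arguments.
Unset Strict Implicit.
Unset Printing Implicit Defensive.

Import GRing.Theory.

Local Open Scope ring_scope.
Local Open Scope quotient_scope.

Section Kernel.
Variables (R : pzRingType) (M N : lmodType R) (g : {linear M -> N}).

Definition ker_pred : {pred M} := fun x => g x == 0.

Fact ker_pred_submod : submod_closed ker_pred.
Proof.
split=> [|a x y]; rewrite !unfold_in ?linear0 // => /eqP gx /eqP gy.
by rewrite linearP gx gy scaler0 addr0.
Qed.

HB.instance Definition _ :=
  GRing.isSubmodClosed.Build R M ker_pred ker_pred_submod.

Record kernel : Type := Kernel { kernel_val : M; _ : kernel_val \in ker_pred }.

HB.instance Definition _ := [isSub for kernel_val].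
HB.instance Definition _ := [Choice of kernel by <:].
HB.instance Definition _ := [SubChoice_isSubZmodule of kernel by <:].
HB.instance Definition _ := [SubZmodule_isSubLmodule of kernel by <:].

Lemma kernelP (x : kernel) : g (kernel_val x) = 0.
Proof. by apply/eqP; exact: (valP x). Qed.

End Kernel.

(* MathComp quotients Z-modules ([Quotient.quot]) but not left modules; the
   scaling is added here. *)
Section Cokernel.
Variables (R : pzRingType) (M N : lmodType R) (g : {linear M -> N}).

Definition im_pred : {pred N} := fun y => `[< exists x, g x = y >].

Fact im_pred_submod : submod_closed im_pred.
Proof.
split=> [|a _ _ /asboolP[x <-] /asboolP[y <-]]; apply/asboolP.
  by exists 0; rewrite linear0.
by exists (a *: x + y); rewrite linearP.
Qed.

HB.instance Definition _ :=
  GRing.isSubmodClosed.Build R N im_pred im_pred_submod.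

Definition coker : Type := Quotient.quot im_pred.

HB.instance Definition _ := GRing.Zmodule.on coker.

Definition coker_pi : N -> coker := \pi_(Quotient.quot im_pred).

Lemma coker_piB : zmod_morphism coker_pi.
Proof. exact: raddfB. Qed.

Lemma coker_pi_surj (q : coker) : exists y, coker_pi y = q.
Proof. by exists (repr (q : Quotient.quot im_pred)); exact: reprK. Qed.

Lemma coker_piP y z : coker_pi y = coker_pi z <-> exists x, g x = y - z.
Proof.
rewrite /coker_pi; split=> [/eqP|].
  by rewrite -Quotient.idealrBE => /asboolP.
by move=> e; apply/eqP; rewrite -Quotient.idealrBE; apply/asboolP.
Qed.

Definition coker_scale (a : R) (q : coker) : coker :=
  coker_pi (a *: repr (q : Quotient.quot im_pred)).

Lemma coker_pi_scale a y : coker_scale a (coker_pi y) = coker_pi (a *: y).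
Proof.
apply/coker_piP; rewrite -scalerBr.
have [x gx] : exists x, g x = repr (coker_pi y : Quotient.quot im_pred) - y.
  by apply/coker_piP; exact: reprK.
by exists (a *: x); rewrite linearZ /= gx.
Qed.

Lemma coker_piD y z : coker_pi (y + z) = coker_pi y + coker_pi z.
Proof. exact: raddfD. Qed.

Fact coker_scaleA a b q :
  coker_scale a (coker_scale b q) = coker_scale (a * b) q.
Proof. by have [y <-] := coker_pi_surj q; rewrite !coker_pi_scale scalerA. Qed.

Fact coker_scale1 : left_id 1 coker_scale.
Proof.
by move=> q; have [y <-] := coker_pi_surj q; rewrite coker_pi_scale scale1r.
Qed.

Fact coker_scaleDr : right_distributive coker_scale +%R.
Proof.
move=> a p q; have [y <-] := coker_pi_surj p; have [z <-] := coker_pi_surj q.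
by rewrite -coker_piD !coker_pi_scale -coker_piD scalerDr.
Qed.

Fact coker_scaleDl q : {morph coker_scale^~ q : a b / a + b}.
Proof.
move=> a b; have [y <-] := coker_pi_surj q.
by rewrite !coker_pi_scale -coker_piD scalerDl.
Qed.

HB.instance Definition _ := GRing.Zmodule_isLmodule.Build R coker
  coker_scaleA coker_scale1 coker_scaleDr coker_scaleDl.

Lemma coker_pi_scalable : scalable coker_pi.
Proof. by move=> a y; rewrite -coker_pi_scale. Qed.

HB.instance Definition _ :=
  GRing.isZmodMorphism.Build N coker coker_pi coker_piB.
HB.instance Definition _ :=
  GRing.isScalable.Build R N coker *:%R coker_pi coker_pi_scalable.

(* The map induced on the cokernel by [h]; it is meaningful when [h]
   vanishes on the image of [g]. *)
Definition coker_lift (P : lmodType R) (h : {linear N -> P}) (q : coker) : P :=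
  h (repr (q : Quotient.quot im_pred)).

Lemma coker_liftE (P : lmodType R) (h : {linear N -> P}) y :
  (forall x, h (g x) = 0) -> coker_lift h (coker_pi y) = h y.
Proof.
move=> hg; apply/eqP; rewrite -subr_eq0 /coker_lift -linearB.
have [x <-] : exists x, g x = repr (coker_pi y : Quotient.quot im_pred) - y.
  by apply/coker_piP; exact: reprK.
by rewrite hg.
Qed.

Lemma coker_lift_linear (P : lmodType R) (h : {linear N -> P}) :
  (forall x, h (g x) = 0) -> linear (coker_lift h).
Proof.
move=> hg a p q; have [y <-] := coker_pi_surj p; have [z <-] := coker_pi_surj q.
by rewrite -linearP !coker_liftE // linearP.
Qed.

End Cokernel.

Section Ext.
Variable R : pzRingType.
Implicit Types U V X Y Z : lmodType R.

(* short exact sequences 0 -> U -> X -> Y -> 0 *)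
Record extension Y U : Type := Extension {
  ext_mid : lmodType R;
  ext_inj : {linear U -> ext_mid};
  ext_proj : {linear ext_mid -> Y};
  ext_injP : injective ext_inj;
  ext_exact : forall x, ext_proj x = 0 <-> exists u, ext_inj u = x;
  ext_projP : forall y, exists x, ext_proj x = y }.

(* Two sequences have the same class in Ext^1(Y, U); by the five lemma, such a
   [phi] is bijective. *)
Definition ext_equiv Y U (E F : extension Y U) : Prop :=
  exists phi : {linear ext_mid E -> ext_mid F},
    (forall u, phi (ext_inj E u) = ext_inj F u) /\
    (forall x, ext_proj F (phi x) = ext_proj E x).

(* The split sequence 0 -> U -> U * Y -> Y -> 0, the zero of Ext^1(Y, U). *)
Section Split.
Variables Y U : lmodType R.

Definition split_inj (u : U) : U * Y := (u, 0).
Definition split_proj (p : U * Y) : Y := p.2.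

Fact split_inj_linear : linear split_inj.
Proof. by move=> a u v; congr pair; rewrite /= scaler0 addr0. Qed.
HB.instance Definition _ :=
  GRing.isLinear.Build R U (U * Y)%type *:%R split_inj split_inj_linear.

Fact split_proj_linear : linear split_proj.
Proof. by []. Qed.
HB.instance Definition _ :=
  GRing.isLinear.Build R (U * Y)%type Y *:%R split_proj split_proj_linear.

Fact split_injP : injective split_inj.
Proof. by move=> u v []. Qed.

Fact split_exact p : split_proj p = 0 <-> exists u, split_inj u = p.
Proof. by split=> [|[u <-] //]; case: p => u y /= ->; exists u. Qed.

Fact split_projP y : exists p, split_proj p = y.
Proof. by exists (0, y). Qed.

Definition split_ext : extension Y U :=
  Extension split_injP split_exact split_projP.

End Split.

(* The pushout of E along j : U -> V has middle term
   (V * X) / {(j u, - a u) | u in U}, where a : U -> X. *)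
Section Pushout.
Variables (Y U V : lmodType R) (j : {linear U -> V}) (E : extension Y U).

Definition push_rel (u : U) : V * ext_mid E := (j u, - ext_inj E u).

Fact push_rel_linear : linear push_rel.
Proof.
by move=> a u v; congr pair; rewrite /= !linearP // opprD scalerN.
Qed.
HB.instance Definition _ := GRing.isLinear.Build R U (V * ext_mid E)%type *:%R
  push_rel push_rel_linear.

Definition push_mid : lmodType R := coker push_rel.

Definition push_inj (v : V) : push_mid := coker_pi push_rel (v, 0).

Fact push_inj_linear : linear push_inj.
Proof.
move=> a u v; rewrite /push_inj -linearP; congr (coker_pi _ _).
by congr pair; rewrite /= scaler0 addr0.
Qed.
HB.instance Definition _ :=
  GRing.isLinear.Build R V push_mid *:%R push_inj push_inj_linear.

Definition push_snd (p : V * ext_mid E) : Y := ext_proj E p.2.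

Fact push_snd_linear : linear push_snd.
Proof. by move=> a p q; rewrite /push_snd /= linearP. Qed.
HB.instance Definition _ :=
  GRing.isLinear.Build R (V * ext_mid E)%type Y *:%R push_snd push_snd_linear.

Fact push_snd_rel u : push_snd (push_rel u) = 0.
Proof.
rewrite /push_snd /= linearN; apply/eqP; rewrite oppr_eq0; apply/eqP.
by apply/ext_exact; exists u.
Qed.

Definition push_proj : push_mid -> Y := coker_lift (g := push_rel) push_snd.

HB.instance Definition _ := GRing.isLinear.Build R push_mid Y *:%R push_proj
  (coker_lift_linear push_snd_rel).

Fact push_projE p : push_proj (coker_pi push_rel p) = ext_proj E p.2.
Proof. by rewrite /push_proj coker_liftE //; exact: push_snd_rel. Qed.

Fact push_injP : injective push_inj.
Proof.
move=> v w /coker_piP[u]; rewrite /push_rel => -[/= ju /eqP].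
rewrite subr0 oppr_eq0 -(linear0 (ext_inj E)) => /eqP/ext_injP u0.
by apply/eqP; rewrite -subr_eq0 -ju u0 linear0.
Qed.

Fact push_exact q : push_proj q = 0 <-> exists v, push_inj v = q.
Proof.
have [[v x] <-] := coker_pi_surj q; rewrite push_projE /=; split.
  move=> /ext_exact[u <-]; exists (v + j u); apply/coker_piP; exists u.
  by congr pair; rewrite /= ?sub0r // addrC addKr.
move=> [w /coker_piP[u [_ /= /eqP]]]; rewrite sub0r eqr_opp => /eqP <-.
by apply/ext_exact; exists u.
Qed.

Fact push_projP y : exists q, push_proj q = y.
Proof.
by have [x <-] := ext_projP E y; exists (coker_pi _ (0, x)); rewrite push_projE.
Qed.

Definition pushout_ext : extension Y V :=
  Extension push_injP push_exact push_projP.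

End Pushout.

(* The pullback of E along i : Z -> Y has middle term
   {(x, z) | b x = i z}, where b : X -> Y. *)
Section Pullback.
Variables (Z Y U : lmodType R) (i : {linear Z -> Y}) (E : extension Y U).

Definition pull_diff (p : ext_mid E * Z) : Y := ext_proj E p.1 - i p.2.

Fact pull_diff_linear : linear pull_diff.
Proof.
move=> a p q; rewrite /pull_diff /= (linearP (ext_proj E)) (linearP i).
by rewrite scalerBr opprD addrACA.
Qed.
HB.instance Definition _ := GRing.isLinear.Build R (ext_mid E * Z)%type Y *:%R
  pull_diff pull_diff_linear.

Definition pull_mid : lmodType R := kernel pull_diff.

Fact pull_inj_subproof u : (ext_inj E u, 0) \in ker_pred pull_diff.
Proof.
rewrite unfold_in /= /pull_diff /= (linear0 i) subr0; apply/eqP/ext_exact.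
by exists u.
Qed.

Definition pull_inj (u : U) : pull_mid := Kernel (pull_inj_subproof u).

Fact pull_inj_linear : linear pull_inj.
Proof.
move=> a u v; apply: val_inj; rewrite linearP /=.
by congr pair; rewrite /= ?linearP // scaler0 addr0.
Qed.
HB.instance Definition _ :=
  GRing.isLinear.Build R U pull_mid *:%R pull_inj pull_inj_linear.

Definition pull_proj (p : pull_mid) : Z := (kernel_val p).2.

Fact pull_proj_linear : linear pull_proj.
Proof. by []. Qed.
HB.instance Definition _ :=
  GRing.isLinear.Build R pull_mid Z *:%R pull_proj pull_proj_linear.

Fact pull_injP : injective pull_inj.
Proof. by move=> u v [/ext_injP]. Qed.

Fact pull_exact p : pull_proj p = 0 <-> exists u, pull_inj u = p.
Proof.
split=> [|[u <-] //]; case: p => -[x z] pP; rewrite /pull_proj /= => z0.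
have /ext_exact[u xE] : ext_proj E x = 0.
  by move: (pP); rewrite unfold_in /= /pull_diff /= z0 linear0 subr0 => /eqP.
by exists u; apply: val_inj => /=; rewrite xE z0.
Qed.

Fact pull_projP z : exists p, pull_proj p = z.
Proof.
have [x xE] := ext_projP E (i z).
have pP : (x, z) \in ker_pred pull_diff.
  by rewrite unfold_in /= /pull_diff /= xE subrr.
by exists (Kernel pP).
Qed.

Definition pullback_ext : extension Z U :=
  Extension pull_injP pull_exact pull_projP.

End Pullback.

(* Ext^1(i, j) : Ext^1(Y, U) -> Ext^1(Z, V), given on representatives; it is
   compatible with [ext_equiv] by [Ext1_map_equiv]. *)
Definition Ext1_map Z Y U V (i : {linear Z -> Y}) (j : {linear U -> V})
    (E : extension Y U) : extension Z V :=
  pullback_ext i (pushout_ext j E).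

Lemma Ext1_map_equiv Z Y U V (i : {linear Z -> Y}) (j : {linear U -> V})
    (E F : extension Y U) :
  ext_equiv E F -> ext_equiv (Ext1_map i j E) (Ext1_map i j F).
Proof.
move=> [phi [phi_inj phi_proj]].
pose h0 (p : V * ext_mid E) : push_mid j F :=
  coker_pi (push_rel j F) (p.1, phi p.2).
have h0L : linear h0.
  move=> a p q; rewrite /h0 -linearP; congr (coker_pi _ _).
  by congr pair; exact: (linearP phi).
pose h : {linear (V * ext_mid E)%type -> push_mid j F} :=
  HB.pack h0 (GRing.isLinear.Build _ _ _ _ h0 h0L).
have hrel u : h (push_rel j E u) = 0.
  rewrite /= /h0 -(linear0 (coker_pi (push_rel j F))); apply/coker_piP.
  by exists u; rewrite subr0 /push_rel /= linearN phi_inj.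
pose k0 : push_mid j E -> push_mid j F := coker_lift (g := push_rel j E) h.
have k0E p : k0 (coker_pi _ p) = h p by rewrite /k0 coker_liftE.
have k0L : linear k0 by exact: coker_lift_linear hrel.
pose k : {linear push_mid j E -> push_mid j F} :=
  HB.pack k0 (GRing.isLinear.Build _ _ _ _ k0 k0L).
have k_inj v : k (push_inj j E v) = push_inj j F v.
  by rewrite /= k0E /= /h0 /= linear0.
have k_proj q : push_proj (k q) = push_proj q.
  have [p <-] := coker_pi_surj q.
  by rewrite /= k0E /= /h0 !push_projE /= phi_proj.
have l0P (p : pull_mid i (pushout_ext j E)) :
    (k (kernel_val p).1, (kernel_val p).2)
      \in ker_pred (pull_diff i (E := pushout_ext j F)).
  have := kernelP p; rewrite unfold_in /= /pull_diff /= => pE.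
  by rewrite [push_proj _](k_proj (kernel_val p).1) pE.
pose l0 p : pull_mid i (pushout_ext j F) := Kernel (l0P p).
have l0L : linear l0.
  move=> a p q; apply: val_inj; rewrite [RHS]linearP /=.
  by congr pair; exact: (linearP k).
pose l : {linear pull_mid i (pushout_ext j E) ->
    pull_mid i (pushout_ext j F)} :=
  HB.pack l0 (GRing.isLinear.Build _ _ _ _ l0 l0L).
exists l; split=> // v; apply: val_inj; congr pair; exact: k_inj.
Qed.

Definition Ext1_map_eq0 Z Y U V (i : {linear Z -> Y}) (j : {linear U -> V}) :=
  forall E : extension Y U, ext_equiv (Ext1_map i j E) (split_ext Z V).

End Ext.

Section Ideals.
Variable R : pzRingType.

(* Pointwise equal elements of {linear M -> N} are equal (functional
   extensionality and proof irrelevance), so this is a class of maps. *)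
Definition hom_class := forall M N : lmodType R, {linear M -> N} -> Prop.

Record is_ideal (I : hom_class) : Prop := IsIdeal {
  ideal0 : forall M N : lmodType R, I M N \0;
  idealB : forall (M N : lmodType R) (f g : {linear M -> N}),
    I M N f -> I M N g -> I M N (f \- g);
  ideal_comp : forall (M' M N N' : lmodType R) (f : {linear N -> N'})
      (g : {linear M -> N}) (h : {linear M' -> M}),
    I M N g -> I M' N' (f \o (g \o h)) }.

(* [I] is the smallest ideal containing all the f k *)
Definition ideal_generated_by (I : hom_class) (K : Type)
    (M N : K -> lmodType R) (f : forall k, {linear M k -> N k}) : Prop :=
  [/\ is_ideal I, forall k, I _ _ (f k) &
    forall J : hom_class, is_ideal J -> (forall k, J _ _ (f k)) ->
      forall (A B : lmodType R) (g : {linear A -> B}), I A B g -> J A B g].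

Definition ext_perp (I : hom_class) : hom_class := fun U V j =>
  forall (Z Y : lmodType R) (i : {linear Z -> Y}), I Z Y i -> Ext1_map_eq0 i j.

Definition is_preenvelope (J : hom_class) (U W : lmodType R)
    (j : {linear U -> W}) : Prop :=
  J U W j /\
  forall (W' : lmodType R) (j' : {linear U -> W'}), J U W' j' ->
    exists h : {linear W -> W'}, forall u, j' u = h (j u).

Definition preenveloping (J : hom_class) : Prop :=
  forall U : lmodType R,
    exists (W : lmodType R) (j : {linear U -> W}), is_preenvelope J j.

End Ideals.

(* Main.v *)
Require Import Defs.
From HB Require Import structures.
From mathcomp Require Import all_boot all_order all_algebra.
From mathcomp Require Import finmap boolp classical_sets fsbigop.
Import GRing.Theory.

Set Implicit Arguments.
Unset Strict Implicit.
Unset Printing Implicit Defensive.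

Local Open Scope ring_scope.

(** The preenvelope is a single pushout; no transfinite iteration occurs.

    For fixed [j : U -> V], the maps [i] with Ext^1(i, j) = 0 form an ideal
    ([ideal_Ext1_map_eq0]): the pullback of a sequence along [i] splits exactly
    when [i] lifts along the epimorphism of that sequence ([pullback_splitP]),
    and maps that lift are visibly stable under differences and compositions.
    As [I] is the smallest ideal containing the [f k], it follows that [j] is
    in the perpendicular class of [I] as soon as Ext^1(f k, j) = 0 for all [k].

    Consider next a sequence 0 -> S -> F -> N -> 0 with [F] projective, and let
    0 -> S -> P -> M -> 0 be its pullback along [f : M -> N].  Every extension
    of [N] by [U] is a pushout of the first sequence along some [g : S -> U].
    Hence Ext^1(f, j) = 0 if and only if, for every [g : S -> U], the map
    [j \o g] extends along S -> P ([Ext1_map_eq0P]).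

    So [j : U -> W] belongs to the perpendicular class of [I] precisely when
    it solves a set of extension problems, indexed by the pairs ([k], [g]) with
    [g : S k -> U].  Gluing all the [P k] to [U] at once along the [g]'s, that
    is, forming the pushout of the direct sum of the S k -> P k along the map
    to [U] with components [g], solves all the problems in the universal way
    ([pushout_family]): any other solution factors through it.  This is exactly
    the preenvelope property.  The index set of pairs is small because [K] is,
    whereas the ideal [I] may be a proper class. *)

(** * Factoring linear maps *)

Definition linear_of (R : pzRingType) (A B : lmodType R) (f : A -> B)
    (fL : linear f) : {linear A -> B} :=
  HB.pack f (GRing.isLinear.Build _ _ _ _ f fL).

Section Factor.
Variables (R : pzRingType) (A B C : lmodType R).

Lemma factor_inj (m : {linear B -> C}) (n : {linear A -> C}) :
    injective m -> (forall a, exists b, m b = n a) ->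
  exists l : {linear A -> B}, forall a, m (l a) = n a.
Proof.
move=> m_inj /choice[l lE].
suff lL : linear l by exists (linear_of lL).
by move=> a x y; apply: m_inj; rewrite linearP !lE linearP.
Qed.

Lemma factor_surj (q : {linear A -> B}) (n : {linear A -> C}) :
    (forall b, exists a, q a = b) -> (forall a, q a = 0 -> n a = 0) ->
  exists l : {linear B -> C}, forall a, l (q a) = n a.
Proof.
move=> /choice[r rK] q0.
have E x y : q x = q y -> n x = n y.
  move=> e; apply/eqP; rewrite -subr_eq0 -linearB; apply/eqP/q0.
  by rewrite linearB e subrr.
suff lL : linear (n \o r) by exists (linear_of lL) => a; apply: E; rewrite rK.
move=> a x y; rewrite /= -linearP; apply: E.
by rewrite linearP !rK.
Qed.

End Factor.

(** * Direct products and direct sums *)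

Section DirectProduct.
Variables (R : pzRingType) (T : Type) (A : T -> lmodType R).

Definition dprod : Type := forall t, A t.

HB.instance Definition _ := gen_eqMixin dprod.
HB.instance Definition _ := gen_choiceMixin dprod.

Definition dprod_zero : dprod := fun=> 0.
Definition dprod_opp (f : dprod) : dprod := fun t => - f t.
Definition dprod_add (f g : dprod) : dprod := fun t => f t + g t.

Fact dprod_addA : associative dprod_add.
Proof.
by move=> f g h; apply/functional_extensionality_dep => t; exact: addrA.
Qed.
Fact dprod_addC : commutative dprod_add.
Proof.
by move=> f g; apply/functional_extensionality_dep => t; exact: addrC.
Qed.
Fact dprod_add0 : left_id dprod_zero dprod_add.
Proof. by move=> f; apply/functional_extensionality_dep => t; exact: add0r. Qed.
Fact dprod_addN : left_inverse dprod_zero dprod_opp dprod_add.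
Proof. by move=> f; apply/functional_extensionality_dep => t; exact: addNr. Qed.

HB.instance Definition _ :=
  GRing.isZmodule.Build dprod dprod_addA dprod_addC dprod_add0 dprod_addN.

Definition dprod_scale (a : R) (f : dprod) : dprod := fun t => a *: f t.

Fact dprod_scaleA a b f :
  dprod_scale a (dprod_scale b f) = dprod_scale (a * b) f.
Proof. by apply/functional_extensionality_dep => t; exact: scalerA. Qed.
Fact dprod_scale1 : left_id 1 dprod_scale.
Proof.
by move=> f; apply/functional_extensionality_dep => t; exact: scale1r.
Qed.
Fact dprod_scaleDr : right_distributive dprod_scale +%R.
Proof.
by move=> a f g; apply/functional_extensionality_dep => t; exact: scalerDr.
Qed.
Fact dprod_scaleDl f : {morph dprod_scale^~ f : a b / a + b}.
Proof.
by move=> a b; apply/functional_extensionality_dep => t; exact: scalerDl.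
Qed.

HB.instance Definition _ := GRing.Zmodule_isLmodule.Build R dprod
  dprod_scaleA dprod_scale1 dprod_scaleDr dprod_scaleDl.

End DirectProduct.

Section DirectSum.
Variables (R : pzRingType) (T : choiceType) (A : T -> lmodType R).

Definition dsum_pred : {pred dprod A} :=
  fun f => `[< exists S : {fset T}, forall t, t \notin S -> f t = 0 >].

Fact dsum_pred_submod : submod_closed dsum_pred.
Proof.
split=> [|a f g /asboolP[S fS] /asboolP[S' gS]]; apply/asboolP.
  by exists fset0.
exists (S `|` S')%fset => t; rewrite in_fsetU negb_or => /andP[/fS f0 /gS g0].
by change (a *: f t + g t = 0); rewrite f0 g0 scaler0 addr0.
Qed.

HB.instance Definition _ :=
  GRing.isSubmodClosed.Build R (dprod A) dsum_pred dsum_pred_submod.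

Record dsum : Type := Dsum { dsum_val : dprod A; _ : dsum_val \in dsum_pred }.

HB.instance Definition _ := [isSub for dsum_val].
HB.instance Definition _ := [Choice of dsum by <:].
HB.instance Definition _ := [SubChoice_isSubZmodule of dsum by <:].
HB.instance Definition _ := [SubZmodule_isSubLmodule of dsum by <:].

Lemma dsumP (f : dsum) :
  exists S : {fset T}, forall t, t \notin S -> dsum_val f t = 0.
Proof. by case: f => f fP; exact/asboolP. Qed.

Fact dsum_in_subproof t (x : A t) :
  dfwith (fun t => 0 : A t) x \in dsum_pred.
Proof.
apply/asboolP; exists [fset t]%fset => t'; rewrite in_fset1 => nt.
by rewrite dfwith_out // eq_sym.
Qed.

Definition dsum_in t (x : A t) : dsum := Dsum (dsum_in_subproof x).

Fact dsum_in_linear t : linear (@dsum_in t).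
Proof.
move=> a x y; apply: val_inj; apply/functional_extensionality_dep => t'.
change (dfwith (fun t => 0 : A t) (a *: x + y) t' =
  a *: dfwith (fun t => 0 : A t) x t' + dfwith (fun t => 0 : A t) y t').
have [<-|nt] := eqVneq t t'; first by rewrite !dfwith_in.
by rewrite !dfwith_out // scaler0 addr0.
Qed.
HB.instance Definition _ t :=
  GRing.isLinear.Build R (A t) dsum *:%R (@dsum_in t) (@dsum_in_linear t).

Fact dsum_eval_linear t : linear (fun f : dsum => dsum_val f t).
Proof. by []. Qed.

Lemma dsum_decomp (S : {fset T}) (f : dsum) :
    (forall t, t \notin S -> dsum_val f t = 0) ->
  f = \sum_(t <- S) dsum_in (dsum_val f t).
Proof.
move=> f0; apply: val_inj; apply/functional_extensionality_dep => t.
change (dsum_val f t = linear_of (dsum_eval_linear t)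
  (\sum_(t <- S) dsum_in (dsum_val f t))).
rewrite linear_sum /=.
have [tS|tS] := boolP (t \in S).
  rewrite (big_fsetD1 t) //= dfwith_in big_seq big1 ?addr0 // => t'.
  by rewrite !inE => /andP[nt _]; rewrite dfwith_out.
rewrite f0 // big_seq big1 // => t' t'S; rewrite dfwith_out //.
by apply: contraNneq tS => <-.
Qed.

Lemma dsum_ext (B : lmodType R) (p q : {linear dsum -> B}) :
  (forall t (x : A t), p (dsum_in x) = q (dsum_in x)) -> p =1 q.
Proof.
move=> pq f; have [S /dsum_decomp ->] := dsumP f.
by rewrite !linear_sum; apply: eq_bigr => t _; exact: pq.
Qed.

Variables (B : lmodType R) (h : forall t, {linear A t -> B}).

(** A sum over the whole of [T] is meaningful since [f] has finite support. *)
Definition dsum_lift (f : dsum) : B :=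
  \sum_(t \in [set: T]%classic) h t (dsum_val f t).

Lemma dsum_liftE (S : {fset T}) f :
  (forall t, t \notin S -> dsum_val f t = 0) ->
  dsum_lift f = \sum_(t <- S) h t (dsum_val f t).
Proof. by move=> f0; apply: fsbigTE => t /f0 ->; rewrite linear0. Qed.

Fact dsum_lift_linear : linear dsum_lift.
Proof.
move=> a f g; have [S fS] := dsumP f; have [S' gS] := dsumP g.
have f0 t : t \notin (S `|` S')%fset -> dsum_val f t = 0.
  by rewrite in_fsetU negb_or => /andP[/fS].
have g0 t : t \notin (S `|` S')%fset -> dsum_val g t = 0.
  by rewrite in_fsetU negb_or => /andP[_ /gS].
have E t : dsum_val (a *: f + g) t = a *: dsum_val f t + dsum_val g t by [].
rewrite !(@dsum_liftE (S `|` S')%fset) // => [|t nt]; last first.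
  by rewrite E f0 // g0 // scaler0 addr0.
rewrite scaler_sumr -big_split; apply: eq_bigr => t _.
by rewrite E linearP.
Qed.
HB.instance Definition _ :=
  GRing.isLinear.Build R dsum B *:%R dsum_lift dsum_lift_linear.

Lemma dsum_lift_in t (x : A t) : dsum_lift (dsum_in x) = h t x.
Proof.
rewrite (@dsum_liftE [fset t]%fset) ?big_seq_fset1 /= ?dfwith_in // => t'.
by rewrite in_fset1 => nt; rewrite dfwith_out // eq_sym.
Qed.

End DirectSum.

(** * Pushout of a family of maps *)

Section PushoutFamily.
Variables (R : pzRingType) (T : choiceType) (U : lmodType R).
Variables (S P : T -> lmodType R).
Variables (a : forall t, {linear S t -> P t}) (g : forall t, {linear S t -> U}).

(** The cokernel of the map from the sum of the [S t] to [U * dsum P] with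
    components [(g t, - a t)]: extending every [j \o g t] along [a t] amounts to
    a map out of [U * dsum P] killing that image. *)
Lemma pushout_family : exists (W : lmodType R) (j : {linear U -> W}),
  (forall t, exists b : {linear P t -> W}, forall s, b (a t s) = j (g t s)) /\
  (forall (W' : lmodType R) (j' : {linear U -> W'}),
    (forall t, exists h : {linear P t -> W'},
       forall s, h (a t s) = j' (g t s)) ->
    exists l : {linear W -> W'}, forall u, j' u = l (j u)).
Proof.
pose rel t (s : S t) : U * dsum P := (g t s, - dsum_in (a t s)).
have relL t : linear (@rel t).
  by move=> c x y; congr pair; rewrite /= !linearP // opprD scalerN.
pose d : {linear dsum S -> (U * dsum P)%type} :=
  dsum_lift (fun t => linear_of (@relL t)).
pose pi := coker_pi d.
have piL (x y : U * dsum P) c : pi (c *: x + y) = c *: pi x + pi y.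
  exact: linearP.
have jL : linear (fun u => pi (u, 0)).
  move=> c x y; rewrite -piL; congr pi.
  by congr pair; rewrite /= scaler0 addr0.
exists (coker d), (linear_of jL); split=> [t|W' j' hP].
  have bL : linear (fun p : P t => pi (0, dsum_in p)).
    move=> c x y; rewrite -piL linearP; congr pi.
    by congr pair; rewrite /= scaler0 addr0.
  exists (linear_of bL) => s; apply/esym/coker_piP; exists (dsum_in s).
  rewrite /= dsum_lift_in /= /rel.
  by congr pair; rewrite /= ?subr0 ?sub0r.
pose h t := projT1 (cid (hP t)).
have hE t s : h t (a t s) = j' (g t s) by exact: (projT2 (cid (hP t))).
pose l0 (p : U * dsum P) := j' p.1 + dsum_lift h p.2.
have l0L : linear l0.
  move=> c x y; rewrite /l0 /= (linearP j').
  rewrite (linearP (dsum_lift h : {linear _ -> _})) /=.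
  by rewrite scalerDr addrACA.
have ld x : linear_of l0L (d x) = 0.
  apply: (dsum_ext (p := linear_of l0L \o d) (q := \0)) => t s.
  by rewrite /= /l0 dsum_lift_in /= /rel /= linearN /= dsum_lift_in hE subrr.
exists (linear_of (coker_lift_linear ld)) => u.
apply: (etrans _ (esym (coker_liftE (u, 0) ld))).
by rewrite /= /l0 /= (linear0 (dsum_lift h : {linear _ -> _})) addr0.
Qed.

End PushoutFamily.

(** * Projective presentations *)

Section Projective.
Variable R : pzRingType.

Definition is_projective (F : lmodType R) : Prop :=
  forall (A B : lmodType R) (q : {linear A -> B}) (n : {linear F -> B}),
    (forall b, exists a, q a = b) ->
    exists l : {linear F -> A}, forall x, q (l x) = n x.

Section FreeModule.
Variable X : choiceType.

Definition regular_family (_ : X) : lmodType R := R^o.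

Definition free_module : lmodType R := dsum regular_family.

Definition free_gen (x : X) : free_module :=
  dsum_in (A := regular_family) (t := x) (1 : R).

Fact scale_vector_linear (B : lmodType R) (b : B) :
  linear (fun a : R^o => (a : R) *: b).
Proof. by move=> c a d; rewrite scalerDl scalerA. Qed.

Definition free_lift (B : lmodType R) (v : X -> B) :
    {linear free_module -> B} :=
  dsum_lift (A := regular_family)
    (fun x => linear_of (scale_vector_linear (v x))).

Lemma free_lift_gen (B : lmodType R) (v : X -> B) x :
  free_lift v (free_gen x) = v x.
Proof. by rewrite /free_lift [LHS]dsum_lift_in; exact: scale1r. Qed.

Lemma free_ext (B : lmodType R) (p q : {linear free_module -> B}) :
  (forall x, p (free_gen x) = q (free_gen x)) -> p =1 q.
Proof.
move=> pq; apply: dsum_ext => x a.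
suff -> : dsum_in (A := regular_family) (t := x) a = (a : R) *: free_gen x.
  by rewrite !linearZ pq.
by rewrite /free_gen -linearZ; congr dsum_in; exact/esym/mulr1.
Qed.

Lemma free_module_projective : is_projective free_module.
Proof.
move=> A B q n /choice[r rK]; exists (free_lift (r \o n \o free_gen)).
apply: (free_ext (p := q \o free_lift _)) => x.
by rewrite /= free_lift_gen /= rK.
Qed.

End FreeModule.

Section FreePresentation.
Variable N : lmodType R.

(** The module [N] itself serves as the set of free generators. *)
Definition free_proj : {linear free_module N -> N} := free_lift id.

Fact free_exact f :
  free_proj f = 0 <-> exists s, kernel_val (g := free_proj) s = f.
Proof.
split=> [f0|[s <-]]; last exact: kernelP.
have fP : f \in ker_pred free_proj by rewrite unfold_in f0.
by exists (Kernel fP).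
Qed.

Fact free_projP x : exists f, free_proj f = x.
Proof. by exists (free_gen x); exact: free_lift_gen. Qed.

Fact kernel_val_linear : linear (@kernel_val _ _ _ free_proj).
Proof. by []. Qed.

Definition free_presentation : extension N (kernel free_proj) :=
  @Extension R N _ _ (linear_of kernel_val_linear) free_proj val_inj
    free_exact free_projP.

End FreePresentation.
End Projective.

(** * Vanishing of Ext^1(i, j) as a lifting property *)

Section Lifting.
Variable R : pzRingType.
Implicit Types U V X Y Z S : lmodType R.

Definition lifts Z Y U (i : {linear Z -> Y}) (E : extension Y U) : Prop :=
  exists s : {linear Z -> ext_mid E}, forall z, ext_proj E (s z) = i z.

Section CanonicalMaps.
Variables (Z Y U V : lmodType R) (i : {linear Z -> Y}) (j : {linear U -> V}).
Variable E : extension Y U.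

(** The canonical map from the middle term of the pullback to that of [E]; the
    map from the latter to that of the pushout is [push_inr] below. *)
Definition pull_fst (p : pull_mid i E) : ext_mid E := (kernel_val p).1.

Fact pull_fst_linear : linear pull_fst.
Proof. by []. Qed.
HB.instance Definition _ := GRing.isLinear.Build R (pull_mid i E) (ext_mid E)
  *:%R pull_fst pull_fst_linear.

Lemma pull_fstP p : ext_proj E (pull_fst p) = i (pull_proj p).
Proof. by apply/eqP; rewrite -subr_eq0; apply/eqP; exact: (kernelP p). Qed.

Definition push_inr (x : ext_mid E) : push_mid j E :=
  coker_pi (push_rel j E) (0, x).

Fact push_inr_linear : linear push_inr.
Proof.
move=> a x y; rewrite /push_inr -linearP; congr (coker_pi _ _).
by congr pair; rewrite /= scaler0 addr0.
Qed.
HB.instance Definition _ := GRing.isLinear.Build R (ext_mid E) (push_mid j E)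
  *:%R push_inr push_inr_linear.

Lemma push_proj_inr x : push_proj (push_inr x) = ext_proj E x.
Proof. exact: push_projE. Qed.

Lemma push_inr_inj u : push_inr (ext_inj E u) = push_inj j E (j u).
Proof.
apply/esym/coker_piP; exists u.
by congr pair; rewrite /= ?sub0r ?subr0.
Qed.

Lemma ext_proj_inj u : ext_proj E (ext_inj E u) = 0.
Proof. by apply/ext_exact; exists u. Qed.

End CanonicalMaps.

Arguments pull_fst {Z Y U} i E p.
Arguments push_inr {Y U V} j E x.

(** A section of the pullback over [Z] is a lift [s] of [i].  The splittings at
    hand are retractions [r] of the pullback onto [U].  Inside the middle term of
    [E], the map [p |-> p.1 - r p] kills the copy of [U] in the pullback, so it
    descends to [s]; conversely [p.1 - s p.2] lies in the copy of [U] in [E], and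
    as a function of [p] it is [r]. *)
Lemma pullback_splitP Z Y U (i : {linear Z -> Y}) (E : extension Y U) :
  ext_equiv (pullback_ext i E) (split_ext Z U) <-> lifts i E.
Proof.
split=> [[phi [phi_inj phi_proj]]|[s sE]].
  have nL :
      linear (fun p : pull_mid i E => pull_fst i E p - ext_inj E (phi p).1).
    move=> c p q; rewrite (linearP phi) (linearP (pull_fst i E)) /=.
    rewrite (linearP (ext_inj E)).
    by rewrite scalerBr opprD addrACA.
  have [|p /pull_exact[u <-]|s sE] :=
      @factor_surj _ _ _ _ (ext_proj (pullback_ext i E)) (linear_of nL).
  - exact: ext_projP.
  - by have /= -> := phi_inj u; rewrite /= subrr.
  exists s => z; have [p <-] := ext_projP (pullback_ext i E) z.
  by rewrite sE /= linearB ext_proj_inj subr0 pull_fstP.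
pose n : {linear pull_mid i E -> ext_mid E} :=
  pull_fst i E \- (s \o @pull_proj _ _ _ _ i E).
have [|p|r rE] := @factor_inj _ _ _ _ (ext_inj E) n.
- exact: ext_injP.
- by apply/ext_exact; rewrite /= linearB sE pull_fstP subrr.
have phiL : linear (fun p : pull_mid i E => (r p, pull_proj p) : U * Z).
  by move=> c p q; congr pair; rewrite linearP.
exists (linear_of phiL); split=> [u|//]; congr pair.
by apply: (@ext_injP _ _ _ E); rewrite rE /= linear0 subr0.
Qed.

Lemma Ext1_map_eq0_lifts Z Y U V (i : {linear Z -> Y}) (j : {linear U -> V}) :
  Ext1_map_eq0 i j <-> forall E : extension Y U, lifts i (pushout_ext j E).
Proof. by split=> H E; apply/pullback_splitP; exact: H. Qed.

(** Stability under [f \o _] uses all extensions at once: a lift of [f \o g]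
    into the pushout of [E] comes from a lift of [g] into the pushout of the
    pullback of [E] along [f]. *)
Lemma ideal_Ext1_map_eq0 U V (j : {linear U -> V}) :
  is_ideal (fun Z Y (i : {linear Z -> Y}) => Ext1_map_eq0 i j).
Proof.
split=> [M N|M N f g|M' M N N' f g h].
- by apply/Ext1_map_eq0_lifts => E; exists \0 => z; rewrite linear0.
- move=> /Ext1_map_eq0_lifts fj /Ext1_map_eq0_lifts gj.
  apply/Ext1_map_eq0_lifts => E.
  have [[s sE] [t tE]] := (fj E, gj E).
  exists (s \- t) => z.
  apply: (etrans (linearB (ext_proj (pushout_ext j E)) _ _)).
  by rewrite sE tE.
move=> /Ext1_map_eq0_lifts gj; apply/Ext1_map_eq0_lifts => E.
have [s sE] := gj (pullback_ext f E).
pose E' := pullback_ext f E.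
(* [c] is the map over [f] from the pushout of [E'] to the pushout of [E] *)
have cL : linear (fun p : V * ext_mid E' =>
    coker_pi (push_rel j E) (p.1, (kernel_val p.2).1)).
  by move=> c p q; rewrite -linearP.
have c0 u : linear_of cL (push_rel j E' u) = 0.
  rewrite -(linear0 (coker_pi (push_rel j E))); apply/coker_piP.
  by exists u; rewrite subr0.
pose c := linear_of (coker_lift_linear c0).
have cE q : push_proj (c q) = f (push_proj q).
  have [p <-] := coker_pi_surj q.
  have -> : c (coker_pi _ p) = linear_of cL p := coker_liftE p c0.
  rewrite /= !push_projE /=.
  by apply/eqP; rewrite -subr_eq0; apply/eqP; exact: (kernelP p.2).
exists (c \o (s \o h)) => z.
by rewrite /= cE; congr (f _); exact: sE.
Qed.

(** This replaces the proper class of all extensions of [Y] by the set of maps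
    from [S] to [U]: projectivity makes every extension of [Y] by [U] a pushout
    of [G], and a splitting of the pullback of [G] pushed out along [j \o g] is an
    extension of [j \o g] to the pullback of [G]. *)
Lemma Ext1_map_eq0P Z Y S (G : extension Y S) U V
    (i : {linear Z -> Y}) (j : {linear U -> V}) :
  is_projective (ext_mid G) ->
  Ext1_map_eq0 i j <->
  forall g : {linear S -> U}, exists h : {linear pull_mid i G -> V},
    forall s, h (pull_inj i G s) = j (g s).
Proof.
move=> Gproj; apply: (iff_trans (Ext1_map_eq0_lifts i j)).
split=> [lift g|ext E].
  (* lifting [i] into the pushout of G along [g] and then [j] suffices; the
     difference between that lift and the tautological map from the pullback
     takes values in [V], and restricts to [j \o g] on [S] *)
  pose E := pushout_ext g G.
  have [s sE] := lift E.
  pose n : {linear pull_mid i G -> push_mid j E} :=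
    (push_inr j E \o (push_inr g G \o pull_fst i G))
      \- (s \o @pull_proj _ _ _ _ i G).
  have [|p|h hE] := @factor_inj _ _ _ _ (ext_inj (pushout_ext j E)) n.
  - exact: ext_injP.
  - apply/ext_exact; apply: (etrans (linearB _ _ _)).
    rewrite sE; apply/eqP; rewrite subr_eq0; apply/eqP.
    by rewrite [LHS]push_proj_inr [LHS]push_proj_inr pull_fstP.
  exists h => s'; apply: (@ext_injP _ _ _ (pushout_ext j E)).
  rewrite hE /= linear0 subr0 [pull_fst _ _ _]/(ext_inj G s') push_inr_inj.
  exact: (push_inr_inj j E (g s')).
(* comparing [G] with [E] gives a map [a] of middle terms over [Y], inducing [g]
   on kernels *)
have [a aE] := Gproj _ _ (ext_proj E) (ext_proj G) (@ext_projP _ _ _ E).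
have [|s|g gE] := @factor_inj _ _ _ _ (ext_inj E) (a \o ext_inj G).
- exact: ext_injP.
- by apply/ext_exact; rewrite /= aE ext_proj_inj.
have [h hE] := ext g.
(* the correction by [h] kills the copy of [S], so [n] descends to a lift *)
pose n : {linear pull_mid i G -> push_mid j E} :=
  (push_inr j E \o (a \o pull_fst i G)) \- (push_inj j E \o h).
have [|p /pull_exact[s <-]|l lE] :=
    @factor_surj _ _ _ _ (ext_proj (pullback_ext i G)) n.
- exact: ext_projP.
- by rewrite /= hE [pull_fst _ _ _]/(ext_inj G s) -[a _]gE push_inr_inj subrr.
exists l => z; have [p <-] := ext_projP (pullback_ext i G) z.
rewrite lE; apply: (etrans (linearB (ext_proj (pushout_ext j E)) _ _)).
rewrite [X in _ - X](ext_proj_inj (pushout_ext j E)) subr0.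
by rewrite [LHS]push_proj_inr /= aE pull_fstP.
Qed.

End Lifting.

(** * The preenvelope *)

Theorem theorem4p1 (R : pzRingType) (I : hom_class R)
  (K : Type) (M N : K -> lmodType R) (f : forall k : K, {linear M k -> N k})
  (hI : ideal_generated_by I f) :
  preenveloping (ext_perp I).
Proof.
move=> U; have [_ If Imin] := hI.
pose G k := free_presentation (N k).
have perpP (V : lmodType R) (j : {linear U -> V}) : ext_perp I j <->
    forall k (g : {linear kernel (free_proj (N k)) -> U}),
      exists h : {linear pull_mid (f k) (G k) -> V},
        forall s, h (pull_inj (f k) (G k) s) = j (g s).
  have fjP k := @Ext1_map_eq0P _ _ _ _ (G k) _ _ (f k) j
    (@free_module_projective R (N k)).
  split=> [jP k|jP Z Y i]; first by apply/fjP; exact: jP.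
  by apply: (Imin _ (ideal_Ext1_map_eq0 j)) => k; exact/fjP.
pose T := {k : K & {linear kernel (free_proj (N k)) -> U}}.
have [W [j [jW univ]]] := @pushout_family R {classic T} U _ _
  (fun t => ext_inj (pullback_ext (f (tag t)) (G (tag t)))) (fun t => tagged t).
exists W, j; split=> [|W' j' /perpP j'P].
  by apply/perpP => k g; exact: (jW (Tagged _ g)).
by apply: univ => t; exact: j'P.
Qed.
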